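(* Let $r,s,n$ be integers with $0\le s\le r<n/2$, and let $G=K^r_n\setminus F$ be an $r$-graph on vertex set $[n]$, where $F$ is a set of $r$-element subsets of $[n]$ with $|F|<\binom{r}{s}^{-1}\binom{n}{r-s}$. Then $\operatorname{rk} M^r_s(G)=\binom{n}{s}$.
   Context: $[n]=\{1,\dots,n\}$. An $r$-graph $G$ on $[n]$ is a set of $r$-element subsets (edges) of $[n]$; $K^r_n$ is the complete $r$-graph on $[n]$ (all $r$-element subsets), and $K^r_n\setminus F$ has as edges all $r$-element subsets of $[n]$ not in $F$. The inclusion matrix $M^r_s(G)$ is the $\{0,1\}$-matrix with rows indexed by the edges of $G$ and columns indexed by the $s$-element subsets of the vertex set $[n]$, whose entry in row $e$ and column $S$ is $1$ if $S\subset e$ and $0$ otherwise; $\operatorname{rk}$ denotes its rank over the rational numbers. *)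

(* Defs.v *)
(* The vertex set [n] = {1, ..., n} is rendered as 'I_n. *)
From mathcomp Require Import all_boot all_order all_algebra.

Set Implicit Arguments.
Unset Strict Implicit.
Unset Printing Implicit Defensive.

Import GRing.Theory Num.Theory.
Local Open Scope ring_scope.

Definition complete_rgraph (n r : nat) : {set {set 'I_n}} :=
  [set e : {set 'I_n} | #|e| == r].

Definition is_rgraph (n r : nat) (G : {set {set 'I_n}}) : bool :=
  G \subset complete_rgraph n r.

(* The uniformity r is carried by G. Rows and columns are numbered through the
   canonical enumerations of G and of the s-subsets; the rank does not depend
   on these orderings. *)
Definition inclusion_matrix (n s : nat) (G : {set {set 'I_n}}) :
    'M[rat]_(#|G|, #|complete_rgraph n s|) :=
  \matrix_(i < #|G|, j < #|complete_rgraph n s|)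
    (if enum_val j \subset enum_val i then 1 else 0).

(* Main.v *)
(* Let x be a nonzero weight function on the s-subsets of V, and let Mx(e) be
   the total weight of the s-subsets of an r-set e.  By induction on s, Mx is
   nonzero on at least C(|V| - 2s, r - s) of the r-subsets of V.  If x is
   constant, Mx vanishes nowhere.  Otherwise, since any two s-sets are joined by
   single-element exchanges, the difference x'(U) = x(U + a) - x(U + b) is
   nonzero for some a, b, on V minus {a, b}; as Mx'(e) = Mx(e + a) - Mx(e + b),
   each (r-1)-set where Mx' is nonzero yields an r-set where Mx is nonzero.
   Finally C(n, r - s) <= C(n - 2s, r - s) C(r, s), so no nonzero Mx is supported
   on F, i.e. the columns of the inclusion matrix are independent. *)
Require Import Defs.
From mathcomp Require Import all_boot all_order all_algebra.
From mathcomp Require Import zify.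
Import GRing.Theory Num.Theory.
Local Open Scope ring_scope.

(** Two uses of Pascal's rule give ['C(m, r) <= 'C(m.+2, r.+1)]; iterate [s] times. This settles the
    constant case, where all [r]-sets count. *)
Lemma leq_bin_sub_double (m r s : nat) :
  (s <= r)%N -> (2 * s <= m)%N -> ('C(m - 2 * s, r - s) <= 'C(m, r))%N.
Proof.
elim: s m r => [|s IHs] m r; first by rewrite !subn0.
case: r => [|r] //.
case: m => [|[|m]] //; first by lia.
rewrite subSS => le_sr le_sm.
have -> : (m.+2 - 2 * s.+1 = m - 2 * s)%N by lia.
apply: leq_trans (IHs m r le_sr _) _; first by lia.
by rewrite binS binS; lia.
Qed.

(** Induction on [k]: multiplying by [k.+1] twice and absorbing it into the binomials leaves only a
    comparison of coefficients, [le_coef]. *)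
Lemma leq_bin_mul_bin (n k s : nat) :
  (2 * (k + s) <= n)%N -> ('C(n, k) <= 'C(n - 2 * s, k) * 'C(k + s, s))%N.
Proof.
rewrite -['C(k + s, s)]bin_sub ?leq_addl // addnK.
elim: k n => [|k IHk] n; first by rewrite !bin0.
case: n => [|n] le_n; first by lia.
have IH := IHk n ltac:(lia).
have -> : (n.+1 - 2 * s = (n - 2 * s).+1)%N by lia.
rewrite -(leq_pmul2l (ltn0Sn k)) -mul_bin_diag mulnA -mul_bin_diag.
rewrite -(leq_pmul2l (ltn0Sn k)) [X in (_ <= X)%N]mulnCA addSn -mul_bin_diag.
have le_coef : (k.+1 * n.+1 <= (n - 2 * s).+1 * (k + s).+1)%N.
  (* The slack [q] removes the truncated subtraction; what remains is
     [2 * s * k.+1 <= s * (2 * k + 2 + q)]. *)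
  have [q def_n] : {q | n = 2 * k + 1 + q + 2 * s}%N.
    by exists (n - (2 * k + 1 + 2 * s))%N; lia.
  have -> : (n - 2 * s = 2 * k + 1 + q)%N by lia.
  by rewrite def_n; nia.
rewrite mulnA; apply: leq_trans (leq_mul le_coef IH) _.
by rewrite mulnACA mulnA.
Qed.

Section SubsetSums.

Variables (T : finType) (R : numFieldType).
Implicit Types (x : {set T} -> R) (V S U e : {set T}).

Definition subset_sum x s e := \sum_(S : {set T} | (S \subset e) && (#|S| == s)) x S.

(** Split the sets by whether they contain [a]. The first summand does not depend on [a], so it
    cancels when the sums over [a |: e] and [b |: e] are subtracted. *)
Lemma subset_sumU1 x s e a : a \notin e ->
  subset_sum x s.+1 (a |: e) =
  subset_sum x s.+1 e + subset_sum (fun U => x (a |: U)) s e.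
Proof.
move=> aNe; rewrite /subset_sum (bigID (fun S => a \in S)) /= addrC.
congr (_ + _).
  apply: eq_bigl => S; rewrite andbAC; congr (_ && _).
  by rewrite -(setU1K aNe) subsetD1 setU1K.
rewrite (reindex_onto (fun U => a |: U) (fun S => S :\ a)); last first.
  by move=> S /andP[_ aS]; rewrite setD1K.
apply: eq_bigl => U; rewrite setU11 andbT.
(* If [a] lies in [U], both conditions fail: [U] is not inside [e], and adding then removing [a]
   does not return [U]. *)
have [aU | aNU] := boolP (a \in U).
  have -> : (U \subset e) = false.
    by apply: contraNF aNe => /subsetP; apply.
  apply/negbTE/negP => /andP[_ /eqP defU].
  by move: aU; rewrite -defU setD11.
rewrite setU1K // eqxx andbT cardsU1 aNU eqSS; congr (_ && _).
by rewrite -subDset setU1K.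
Qed.

(** Induction on the size of [S :\: S']: trading some [a] of [S :\: S'] for some [b] of [S' :\: S]
    lowers it by one and stays inside [V]. *)
Lemma exchange_const x V s :
    (forall U a b, a |: U \subset V -> b |: U \subset V -> a \notin U ->
       b \notin U -> a != b -> #|U| = s -> x (a |: U) = x (b |: U)) ->
  forall S S', S \subset V -> S' \subset V -> #|S| = s.+1 -> #|S'| = s.+1 ->
  x S = x S'.
Proof.
move=> exch S S'; have [k] := ubnP #|S :\: S'|.
elim: k S => // k IHk S leSk SV S'V cS cS'.
have [-> // | neSS'] := eqVneq S S'.
have /subsetPn[a aS aNS'] : ~~ (S \subset S').
  by apply: contra neSS' => sSS'; rewrite eqEcard sSS' cS cS' leqnn.
have /subsetPn[b bS' bNS] : ~~ (S' \subset S).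
  by apply: contra neSS' => sSS'; rewrite eq_sym eqEcard sSS' cS cS' leqnn.
have bNSa : b \notin S :\ a by rewrite inE negb_and bNS orbT.
have cSa : #|S :\ a| = s by move: (cardsD1 a S); rewrite aS cS; lia.
have bSaV : b |: (S :\ a) \subset V.
  by rewrite subUset sub1set (subsetP S'V) //= (subset_trans (subD1set _ _)).
rewrite -{1}(setD1K aS) (exch _ a b) ?setD1K ?setD11 //.
  apply: IHk => //; last by rewrite cardsU1 bNSa cSa.
  have <- : (S :\: S') :\ a = (b |: (S :\ a)) :\: S'.
    apply/setP => z; rewrite !inE.
    by case: (z =P b) => [->|_] /=; rewrite ?bS' ?andbF // andbCA.
  by move: leSk; rewrite (cardsD1 a) inE aS aNS'.
by apply: contraNneq bNS => <-.
Qed.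

Lemma card_subset_sum_neq0 x V r s S :
    (s <= r)%N -> (2 * s <= #|V|)%N -> S \subset V -> #|S| = s -> x S != 0 ->
  ('C(#|V| - 2 * s, r - s) <=
   #|[set e : {set T} | [&& e \subset V, #|e| == r & subset_sum x s e != 0%R]]|)%N.
Proof.
(* Shared by the base case, where the empty set is the only one, and the case without a bad
   exchange: each sum is ['C(q, t)] times [y S0], nonzero in characteristic zero. *)
have const_case t q (y : {set T} -> R) (W S0 : {set T}) : (t <= q)%N -> (2 * t <= #|W|)%N -> y S0 != 0 ->
    (forall S', S' \subset W -> #|S'| = t -> y S' = y S0) ->
  ('C(#|W| - 2 * t, q - t) <=
   #|[set e : {set T} | [&& e \subset W, #|e| == q & subset_sum y t e != 0%R]]|)%N.
  move=> le_tq le_tW yS0 const_y.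
  apply: leq_trans (leq_bin_sub_double _ _ _ le_tq le_tW) _.
  rewrite -cards_draws; apply/subset_leq_card/subsetP => e.
  rewrite !inE => /andP[eW /eqP ce]; rewrite eW ce eqxx /= /subset_sum.
  rewrite (eq_bigr (fun=> y S0)); last first.
    by move=> S' /andP[S'e /eqP cS']; apply: const_y; rewrite ?(subset_trans S'e).
  rewrite sumr_const -mulr_natl mulf_neq0 // pnatr_eq0 -lt0n.
  suff -> : #|[pred S' : {set T} | (S' \subset e) && (#|S'| == t)]| = 'C(q, t).
    by rewrite bin_gt0.
  by rewrite -ce -cards_draws cardsE.
elim: s x V r S => [|s IHs] x V r S le_sr le_sV SV cS xS.
  apply: (const_case _ _ _ _ S) => // S' _ /cards0_eq->.
  by rewrite (cards0_eq cS).
pose bad (U : {set T}) a b := [&& a |: U \subset V, b |: U \subset V, a \notin U,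
  b \notin U, a != b, #|U| == s & x (a |: U) != x (b |: U)].
have [/existsP[U /existsP[a /existsP[b]]] | no_bad] :=
    boolP [exists U, exists a, exists b, bad U a b]; last first.
  apply: (const_case _ _ _ _ S) => // S' S'V cS'.
  apply: (@exchange_const x V s) => // U a b aUV bUV aNU bNU ab cU.
  apply: contraNeq no_bad => neq_x.
  apply/existsP; exists U; apply/existsP; exists a; apply/existsP; exists b.
  by rewrite /bad aUV bUV aNU bNU ab cU eqxx.
case/and5P=> aUV bUV aNU bNU /and3P[ab /eqP cU neq_x].
move: aUV bUV; rewrite !subUset !sub1set => /andP[aV UV] /andP[bV _].
pose W := V :\ a :\ b.
have cV : #|V| = #|W|.+2.
  by rewrite (cardsD1 a) aV (cardsD1 b (V :\ a)) !inE eq_sym ab bV.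
case: r le_sr => [|r] // le_sr.
pose x' (S' : {set T}) := x (a |: S') - x (b |: S').
have UW : U \subset W by rewrite !subsetD1 UV aNU bNU.
have {}IHs := IHs x' W r U le_sr ltac:(lia) UW cU.
(* Losing two points of [V] and one unit of both [s] and [r] leaves the bound unchanged. *)
rewrite cV subSS; have -> : (#|W|.+2 - 2 * s.+1 = #|W| - 2 * s)%N by lia.
apply: leq_trans (IHs _) _; first by rewrite subr_eq0.
(* Either choice is undone by deleting [a] and [b], so [lift] is injective on subsets of [W]. *)
pose lift (e : {set T}) := if subset_sum x s.+1 (a |: e) != 0 then a |: e else b |: e.
have liftK e : e \subset W -> lift e :\ a :\ b = e.
  rewrite !subsetD1 => /andP[/andP[_ aNe] bNe].
  apply/setP => z; rewrite /lift !inE.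
  case: (z =P a) => [->|/eqP/negbTE za]; first by rewrite andbF (negbTE aNe).
  case: (z =P b) => [->|/eqP/negbTE zb]; first by rewrite (negbTE bNe).
  by case: ifP; rewrite !inE ?za ?zb.
set E := [set e | _]; rewrite -(@card_in_imset _ _ lift E); last first.
  move=> e e'; rewrite !inE => /andP[eW _] /andP[e'W _] eq_lift.
  by rewrite -(liftK e) // eq_lift liftK.
apply/subset_leq_card/subsetP => _ /imsetP[e + ->].
rewrite !inE !subsetD1 => /and3P[/andP[/andP[eV aNe] bNe] /eqP ce sum_x'].
have sum_diff : subset_sum x' s e =
    subset_sum x s.+1 (a |: e) - subset_sum x s.+1 (b |: e).
  rewrite !subset_sumU1 // /x' /subset_sum sumrB.
  by rewrite opprD addrACA subrr add0r.
rewrite /lift; case: ifPn => [sum_a | /negPn/eqP sum_a].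
  by rewrite subUset sub1set aV eV cardsU1 aNe ce eqxx.
rewrite subUset sub1set bV eV cardsU1 bNe ce eqxx /=.
by move: sum_x'; rewrite sum_diff sum_a sub0r oppr_eq0.
Qed.

End SubsetSums.

Theorem lemma6 (n r s : nat) (F G : {set {set 'I_n}})
    (hsr : (s <= r)%N)
    (hrn : (r%:R : rat) < n%:R / 2%:R)
    (hF : is_rgraph r F)
    (hFcard : (#|F|%:R : rat) < 'C(r, s)%:R^-1 * 'C(n, r - s)%:R)
    (hG : G = complete_rgraph n r :\: F) :
  \rank (inclusion_matrix s G) = 'C(n, s).
Proof.
have ltrn : (2 * r < n)%N.
  by move: hrn; rewrite ltr_pdivlMr ?ltr0n // -natrM ltr_nat mulnC.
have ltF : (#|F| < 'C(n - 2 * s, r - s))%N.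
  move: hFcard; rewrite mulrC ltr_pdivlMr ?ltr0n ?bin_gt0 // -natrM ltr_nat.
  have := @leq_bin_mul_bin n (r - s) s; rewrite subnK // => /(_ ltac:(lia)) le_C.
  by move/leq_trans/(_ le_C); rewrite ltn_pmul2r ?bin_gt0.
have <- : #|complete_rgraph n s| = 'C(n, s) by rewrite card_draws card_ord.
rewrite -mxrank_tr; apply/eqP/inj_row_free => v vM0.
(* The kernel vector [v], extended by zero to sets of size other than [s]. *)
pose x S := \sum_j (if enum_val j == S then v 0 j else 0).
have xE j : x (enum_val j) = v 0 j.
  rewrite /x (bigD1 j) //= eqxx big1 ?addr0 // => i /negbTE ij.
  by rewrite (inj_eq enum_val_inj) ij.
have sum_xE e : subset_sum _ _ x s e =
    \sum_j v 0 j * (if enum_val j \subset e then 1 else 0).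
  rewrite /subset_sum /x exchange_big /=; apply: eq_bigr => j _.
  rewrite -big_mkcondr /=.
  have : enum_val j \in complete_rgraph n s := enum_valP j.
  rewrite inE => cj; case: ifP => je.
    rewrite (big_pred1 (enum_val j)) ?mulr1 // => S /=.
    by rewrite [RHS]eq_sym; case: (enum_val j =P S) => [<-|_]; rewrite ?je ?cj ?andbF.
  rewrite mulr0 big_pred0 // => S.
  by apply/negP => /andP[/andP[Se _] /eqP jS]; rewrite -jS je in Se.
have sum_x0 e : e \in G -> subset_sum _ _ x s e = 0.
  move=> eG; move/rowP/(_ (enum_rank_in eG e)): vM0; rewrite !mxE => vM0.
  rewrite sum_xE -[RHS]vM0; apply: eq_bigr => j _.
  by rewrite !mxE enum_rankK_in.
apply/rowP => j; rewrite mxE -xE; apply/eqP/negPn/negP => xj.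
have /eqP cj : #|enum_val j| == s by have := enum_valP j; rewrite inE.
have := @card_subset_sum_neq0 _ _ x [set: 'I_n] r s _ hsr _ (subsetT _) cj xj.
rewrite cardsT card_ord => /(_ ltac:(lia)); apply/negP; rewrite -ltnNge.
(* Sums over edges of [G] vanish, so every [r]-set with nonzero sum lies in [F], which is too
   small. *)
apply: leq_ltn_trans ltF; apply/subset_leq_card/subsetP => e.
rewrite inE => /and3P[_ ce]; apply: contraR => eNF.
by rewrite sum_x0 // hG !inE eNF.
Qed.
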